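(* Let $(R,\mathfrak m)$ be a Noetherian local ring. Let $I\subseteq R$ be a regular ideal (that is, an ideal containing a nonzerodivisor of $R$), and assume that the homothety map $R\to\operatorname{End}_R(I)$, sending $r\in R$ to multiplication by $r$ on $I$, is an isomorphism. Then the following conditions are equivalent: (i) $\operatorname{pd}_R I\le 1$; (ii) $\operatorname{Fitt}_1^R(I)\cong I$ as $R$-modules.
   Context: All rings are commutative with identity. $\operatorname{pd}_R$ denotes projective dimension over $R$. Fitting ideal: if $M$ is a finitely generated module over a Noetherian ring $R$ and $R^m\xrightarrow{A}R^n\to M\to 0$ is a finite free presentation, then $\operatorname{Fitt}_1^R(M)=I_{n-1}(A)$, the ideal of $R$ generated by the $(n-1)\times(n-1)$ minors of the matrix $A$, with the conventions $I_t(A)=R$ for $t\le 0$ and $I_t(A)=0$ if $t$ exceeds the number of rows or columns of $A$. This ideal is independent of the chosen presentation. In particular $\operatorname{Fitt}_1^R(M)=R$ if $M$ is cyclic. *)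

(* Defs.v *)
From HB Require Import structures.
From mathcomp Require Import all_boot all_order all_algebra.
From mathcomp Require Import boolp classical_sets.

Set Implicit Arguments.
Unset Strict Implicit.
Unset Printing Implicit Defensive.

Import GRing.Theory.
Local Open Scope ring_scope.

(* A submodule is a library closed predicate, hence a boolean one; the axioms *)
(* of boolp make every Prop-valued subset boolean, so none is lost.           *)

Definition submod_type (R : comNzRingType) (V : lmodType R)
    (S : submodClosed V) := {x : V | x \in S}.

Section SubmodType.
Variables (R : comNzRingType) (V : lmodType R) (S : submodClosed V).

HB.instance Definition _ := SubChoice.on (submod_type S).
HB.instance Definition _ :=
  [SubChoice_isSubLmodule of submod_type S by <:].

End SubmodType.

Notation ideal R := (submodClosed (R : comNzRingType)^o).

Section Rings.
Variable R : comNzRingType.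

Section IdealGen.
Variable G : set R.

Definition ideal_gen : {pred R^o} := fun x : R =>
  `[< exists2 s : seq (R * R), (forall p, p \in s -> G p.2)
        & x = \sum_(p <- s) p.1 * p.2 >].

Fact ideal_gen_closed : GRing.submod_closed ideal_gen.
Proof.
split=> [|a x y /asboolP[s Gs ->] /asboolP[t Gt ->]]; apply/asboolP.
  by exists [::]; rewrite ?big_nil.
exists ([seq (a * p.1, p.2) | p <- s] ++ t) => [p|].
  by rewrite mem_cat => /orP[/mapP[q /Gs Gq ->]|/Gt].
rewrite big_cat big_map /=; congr (_ + _); rewrite /GRing.scale /= mulr_sumr.
by apply: eq_bigr => p _; rewrite mulrA.
Qed.

HB.instance Definition _ :=
  GRing.isSubmodClosed.Build R R^o ideal_gen ideal_gen_closed.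

End IdealGen.

Definition noetherian :=
  forall J : ideal R, exists s : seq R, J =i ideal_gen [set x | x \in s].

Definition maximal_ideal (m : ideal R) :=
  (1 : R^o) \notin m /\
  forall J : ideal R, {subset m <= J} -> (1 : R^o) \notin J -> J =i m.

Definition local_ring (m : ideal R) :=
  maximal_ideal m /\ forall m' : ideal R, maximal_ideal m' -> m' =i m.

Definition regular_ideal (I : ideal R) :=
  exists2 x : R, (x : R^o) \in I & GRing.lreg x.

End Rings.

Section Modules.
Variable R : comNzRingType.

Definition isomorphic (M N : lmodType R) :=
  exists f : {linear M -> N}, bijective f.

Definition homothety (M : lmodType R) (r : R) : {linear M -> M} :=
  @GRing.scale R M r.

Definition projective (P : lmodType R) :=
  forall (M N : lmodType R) (g : {linear M -> N}) (f : {linear P -> N}),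
    (forall y, exists x, g x = y) ->
    exists h : {linear P -> M}, forall x, g (h x) = f x.

Definition projective_resolution (M : lmodType R) (P : nat -> lmodType R)
    (d : forall i, {linear P i.+1 -> P i}) (e : {linear P 0 -> M}) :=
  [/\ forall i, projective (P i),
      forall y, exists x, e x = y,
      forall x, e x = 0 <-> exists z, x = d 0 z
    & forall i x, d i x = 0 <-> exists z, x = d i.+1 z].

Definition pd_le (M : lmodType R) (n : nat) :=
  exists (P : nat -> lmodType R) (d : forall i, {linear P i.+1 -> P i})
         (e : {linear P 0 -> M}),
    projective_resolution d e /\ forall i, (n < i)%N -> forall x : P i, x = 0.

(* For t = 0 this is R, the 0 x 0 determinant being 1, and if t exceeds a     *)
(* dimension of A there is no strictly increasing map, so it is 0.            *)
Definition minors_ideal (n m : nat) (A : 'M[R]_(n, m)) (t : nat) : ideal R :=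
  ideal_gen [set x | exists (f : 'I_t -> 'I_n) (g : 'I_t -> 'I_m),
    [/\ {homo f : i j / (i < j)%N}, {homo g : i j / (i < j)%N}
      & x = \det (mxsub f g A)]].

Definition presents (n m : nat) (A : 'M[R]_(n, m)) (M : lmodType R) :=
  exists p : {linear 'cV[R]_n -> M},
    (forall y, exists v, p v = y) /\
    forall v, p v = 0 <-> exists w : 'cV[R]_m, v = A *m w.

Definition presentation (M : lmodType R) : {d : nat * nat & 'M[R]_(d.1, d.2)} :=
  xget (Tagged (fun d => 'M[R]_(d.1, d.2)) (0 : 'M[R]_((0, 0).1, (0, 0).2)))
       [set A | presents (tagged A) M].

(* The value does not depend on the presentation chosen; it is meaningless    *)
(* when M has no finite presentation.  Truncated subtraction is harmless, as  *)
(* the ideal of t-minors is R for all t <= 0.                                 *)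
Definition fitting (i : nat) (M : lmodType R) : ideal R :=
  minors_ideal (tagged (presentation M)) ((tag (presentation M)).1 - i).

End Modules.

(* Main.v *)
Require Import Defs.
From HB Require Import structures.
From mathcomp Require Import all_boot all_algebra all_fingroup.
From mathcomp Require Import boolp classical_sets.

Set Implicit Arguments.
Unset Strict Implicit.
Unset Printing Implicit Defensive.

Import GRing.Theory.
Local Open Scope ring_scope.

(** Present [I] by a surjection [p] from [R^(n+1)] and a matrix [A] whose
    columns span [ker p].  For a matrix [B] with [n] columns in [ker p], write
    [D_B v = \det (v | B)] ([bordered B v]).  Cramer's rule gives two
    identities:
    - [D_B v * p w = p v * D_B w] ([bordered_ker_cross]), so that, [I] being
      faithful, [D_B] vanishes on [ker p] and factors through a linear form on
      [I];
    - [D_B v *: w = D_B w *: v + B *m (coefficients D_B' v)], where [B'] is [B]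
      with one column replaced by [w] ([bordered_cramer]).
    The values of the [D_B], for [B] made of columns of [A], generate the
    Fitting ideal, and by Cauchy-Binet it contains [D_B v] for all other [B]
    with columns in [ker p] as well.

    From an isomorphism [psi] of the Fitting ideal with [I] to the bound on the
    projective dimension: composing [psi] with the form induced by [D_B] gives
    an endomorphism of [I], that is, a scalar [r_B].  If all the [r_B] were in
    the maximal ideal [m], then [I = m I], against Nakayama's lemma; so some
    [r_B] is a unit ([minor_map_unit]).  For this [B], each [D_B'] is a scalar
    multiple of [D_B], and the second identity, where [D_B v] can be cancelled
    for [v] varying, writes every [w] in [ker p] as [B *m u].  Hence
    [0 -> R^n -> R^(n+1) -> I -> 0] is exact.

    From the bound on the projective dimension to the isomorphism: [ker p] is
    projective and finitely generated over a local ring, hence free: it is the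
    image of an injective matrix [C] ([pd1_injective_presentation]).  If [r] in
    [I] is regular and [r = p c], the matrix [(c | C)] has a two-sided inverse
    up to the factor [r].  So it is square, its determinant [D_C c] is regular,
    and [D_C] induces an isomorphism of [I] with its image, which is the Fitting
    ideal because [C] and [A] have the same image ([hilbert_burch]). *)

(** * Bordered determinants and Cramer's rule *)

Section Determinants.
Variable R : comNzRingType.

Lemma adj_mul_col n (B : 'M[R]_n) (w : 'cV[R]_n) k :
  (\adj B *m w) k 0 = \det (\matrix_(i, j) if j == k then w i 0 else B i j).
Proof.
rewrite (expand_det_col _ k) mxE; apply: eq_bigr => i _.
rewrite !mxE eqxx mulrC; congr (_ * (_ * \det _)); apply/matrixP => a b.
by rewrite !mxE eq_sym (negPf (neq_lift _ _)).
Qed.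

Lemma det_colsub_perm t (B : 'M[R]_t) (h : 'I_t -> 'I_t) :
  injective h -> exists b : bool, \det (colsub h B) = (-1) ^+ b * \det B.
Proof.
move=> h_inj; exists (perm h_inj).
have -> : colsub h B = col_perm (perm h_inj) B.
  by apply/matrixP => i j; rewrite !mxE permE.
by rewrite col_permE det_mulmx det_perm odd_permV mulrC.
Qed.

Lemma det_rowsub_perm t (B : 'M[R]_t) (h : 'I_t -> 'I_t) :
  injective h -> exists b : bool, \det (rowsub h B) = (-1) ^+ b * \det B.
Proof.
move=> /(det_colsub_perm B^T)[b Db]; exists b.
rewrite -[in RHS]det_tr -Db -det_tr; congr (\det _).
by apply/matrixP=> i j; rewrite !mxE.
Qed.

(** The Cauchy-Binet formula before grouping by column sets: the sum runs over
    all maps, and [minor_mem] brings each term back to an increasing one. *)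
Lemma det_mulmx_cols t m (B : 'M[R]_(t, m)) (W : 'M[R]_(m, t)) :
  \det (B *m W) =
    \sum_(g : {ffun 'I_t -> 'I_m}) (\prod_i W (g i) i) * \det (colsub g B).
Proof.
rewrite -det_tr trmx_mul.
transitivity (\sum_(s : 'S_t) (-1) ^+ s *
   \sum_(g : {ffun 'I_t -> 'I_m}) \prod_i (W (g i) i * B (s i) (g i))).
  apply: eq_bigr => s _; congr (_ * _).
  rewrite -(bigA_distr_bigA (fun i j => W j i * B (s i) j)).
  by apply: eq_bigr => i _; rewrite mxE; apply: eq_bigr => j _; rewrite !mxE.
under eq_bigr do rewrite big_distrr /=.
rewrite exchange_big; apply: eq_bigr => g _ /=.
rewrite -det_tr [X in _ = _ * X]/determinant big_distrr /=.
apply: eq_bigr => s _; rewrite big_split /= mulrCA; congr (_ * (_ * _)).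
by apply: eq_bigr => i _; rewrite !mxE.
Qed.

(** In the expansion of [det_mulmx_cols], every map repeats a column. *)
Lemma det_mulmx_narrow a b (M : 'M[R]_(a, b)) (N : 'M[R]_(b, a)) :
  (b < a)%N -> \det (M *m N) = 0.
Proof.
move=> lt_ba; rewrite det_mulmx_cols big1 // => g _.
have /injectivePn[i [j neq_ij eq_g]] : ~~ injectiveb g.
  apply: contraL lt_ba => /injectiveP g_inj; rewrite -leqNgt.
  by rewrite -[X in (X <= _)%N]card_ord -[X in (_ <= X)%N]card_ord (leq_card g).
rewrite -det_tr (determinant_alternate neq_ij) ?mulr0 // => k.
by rewrite !mxE eq_g.
Qed.

Definition bordered n (A : 'M[R]_(n.+1, n)) (v : 'cV[R]_n.+1) : R :=
  \det (row_mx v A : 'M_n.+1).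

Lemma borderedE n (A : 'M[R]_(n.+1, n)) v :
  bordered A v = \sum_i v i 0 * ((-1) ^+ i * \det (row' i A)).
Proof.
rewrite /bordered (expand_det_col _ 0); apply: eq_bigr => i _.
have -> : (row_mx v A : 'M_n.+1) i 0 = v i 0.
  by rewrite -(row_mxEl v A i 0); congr (_ _ _); apply: val_inj.
rewrite /cofactor addn0; congr (_ * (_ * \det _)).
apply/matrixP => a b; rewrite !mxE.
case: splitP => [j|j /= Dj]; first by rewrite ord1.
by congr (A _ _); apply: val_inj; case: Dj.
Qed.

Lemma borderedP n (A : 'M[R]_(n.+1, n)) a u v :
  bordered A (a *: u + v) = a * bordered A u + bordered A v.
Proof.
rewrite !borderedE big_distrr -big_split /=.
by apply: eq_bigr => i _; rewrite !mxE mulrDl mulrA.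
Qed.

Lemma borderedZ n (A : 'M[R]_(n.+1, n)) a u :
  bordered A (a *: u) = a * bordered A u.
Proof.
rewrite !borderedE big_distrr; apply: eq_bigr => i _ /=.
by rewrite mxE mulrA.
Qed.

Lemma bordered_delta n (A : 'M[R]_(n.+1, n)) i :
  bordered A (delta_mx i 0) = (-1) ^+ i * \det (row' i A).
Proof.
rewrite borderedE (bigD1 i) //= mxE !eqxx mul1r big1 ?addr0 // => j neq_ji.
by rewrite mxE (negPf neq_ji) mul0r.
Qed.

Definition set_col m n (A : 'M[R]_(m, n)) k (w : 'cV[R]_m) : 'M[R]_(m, n) :=
  \matrix_(i, j) if j == k then w i 0 else A i j.

(** By Cramer's rule: solving [row_mx v A *m z = \det _ *: w] replaces the
    column [v] by [w] in the first coordinate of [z], and a column of [A] by [w]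
    in the others. *)
Lemma adj_bordered n (A : 'M[R]_(n.+1, n)) (v w : 'cV[R]_n.+1) :
  \adj (row_mx v A : 'M_n.+1) *m w =
    col_mx (bordered A w)%:M (\col_k bordered (set_col A k w) v) :> 'cV_(1 + n).
Proof.
apply/matrixP => i j; rewrite ord1 adj_mul_col -[i]splitK.
case: (split i) => k /=; rewrite ?col_mxEu ?col_mxEd mxE ?ord1 ?eqxx.
  congr (\det _); apply/matrixP => a b; rewrite !mxE.
  by case: splitP => l Dl; rewrite -val_eqE /= Dl ?ord1.
congr (\det _); apply/matrixP => a b; rewrite !mxE.
case: splitP => l Dl; rewrite -val_eqE /= Dl ?ord1 //.
by rewrite eqn_add2l mxE.
Qed.

(** The row vector [x *m row_mx v A] has only its first entry [x *m v] nonzero;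
    multiply it by the adjugate. *)
Lemma bordered_cross n (A : 'M[R]_(n.+1, n)) (x : 'rV[R]_n.+1) v w :
  x *m A = 0 -> bordered A v * (x *m w) 0 0 = (x *m v) 0 0 * bordered A w.
Proof.
move=> xA0; set B : 'M_n.+1 := row_mx v A.
have xB : x *m B = row_mx (x *m v) 0 :> 'rV_(1 + n).
  by rewrite (mul_mx_row x v A : x *m B = _) xA0.
have /(congr1 (fun M => (M *m w) 0 0)) : x *m (B *m \adj B) = x *m (\det B)%:M.
  by rewrite mul_mx_adj.
rewrite mul_mx_scalar -scalemxAl [X in _ = X]mxE => <-.
rewrite mulmxA xB -mulmxA adj_bordered.
rewrite (mul_row_col (x *m v) 0) mul0mx addr0 mul_mx_scalar mxE mulrC.
by [].
Qed.

Lemma bordered_cramer n (A : 'M[R]_(n.+1, n)) v w :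
  bordered A v *: w =
    bordered A w *: v + A *m (\col_k bordered (set_col A k w) v).
Proof.
set B : 'M_n.+1 := row_mx v A.
rewrite -mul_scalar_mx -[X in X *m w](mul_mx_adj B) -mulmxA adj_bordered.
by rewrite (mul_row_col v A) mul_mx_scalar.
Qed.

Lemma bordered_mul n (A : 'M[R]_(n.+1, n)) (W : 'M[R]_n) v :
  bordered (A *m W) v = \det W * bordered A v.
Proof.
have -> : bordered (A *m W) v = \det ((row_mx v A : 'M_n.+1) *m
             (block_mx 1%:M 0 0 W : 'M_(1 + n))).
  by rewrite (mul_row_block v A) !mulmx0 addr0 add0r mulmx1.
rewrite det_mulmx mulrC; congr (_ * _).
by rewrite (det_ublock (1%:M : 'M_1) 0 W) det1 mul1r.
Qed.

(** The vector [(0, u)] is in the kernel of [row_mx v A], hence is killed by its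
    determinant. *)
Lemma bordered_ann n (A : 'M[R]_(n.+1, n)) v (u : 'cV[R]_n) :
  A *m u = 0 -> bordered A v *: u = 0.
Proof.
move=> Au0; pose B : 'M_n.+1 := row_mx v A.
have /(congr1 (mulmx (\adj B))) : B *m (col_mx 0 u : 'cV_(1 + n)) = 0.
  by rewrite (mul_row_col v A) mulmx0 Au0 addr0.
rewrite mulmx0 mulmxA mul_adj_mx mul_scalar_mx.
by move/(congr1 (@dsubmx R 1 n 1)); rewrite linear0 linearZ /= col_mxKd.
Qed.

End Determinants.

(** * Generated ideals and ideals of minors *)

Section Ideals.
Variable R : comNzRingType.
Implicit Types (G : set R) (J : ideal R).

Lemma ideal_gen_mem G x : G x -> (x : R^o) \in ideal_gen G.
Proof.
move=> Gx; apply/asboolP; exists [:: (1, x)]; last by rewrite big_seq1 mul1r.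
by move=> p; rewrite inE => /eqP->.
Qed.

Lemma ideal_gen_ind G (P : R -> Prop) :
    P 0 -> (forall a x y, G x -> P y -> P (a * x + y)) ->
  forall z, (z : R^o) \in ideal_gen G -> P z.
Proof.
move=> P0 PS z /asboolP[s Gs ->]; elim: s Gs => [|q s IHs] Gs.
  by rewrite big_nil.
rewrite big_cons; apply: PS; first by apply: Gs; rewrite mem_head.
by apply: IHs => r s_r; apply: Gs; rewrite inE s_r orbT.
Qed.

Lemma ideal_mulr J a x : (x : R^o) \in J -> (a * x : R^o) \in J.
Proof. exact: (rpredZ (s := J)). Qed.

Lemma ideal_sub J x y :
  (x : R^o) \in J -> (y : R^o) \in J -> (x - y : R^o) \in J.
Proof. by move=> Jx Jy; rewrite -mulN1r rpredD ?ideal_mulr. Qed.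

Lemma ideal_sign J (b : bool) x :
  (x : R^o) \in J -> ((-1) ^+ b * x : R^o) \in J.
Proof. exact: ideal_mulr. Qed.

Lemma submod_valZ J a (y : submod_type J) : val (a *: y) = a * val y :> R.
Proof. by []. Qed.

Lemma submod_val_sum J n (y : 'I_n -> submod_type J) :
  val (\sum_i y i) = \sum_i (val (y i) : R).
Proof. by elim/big_rec2: _ => // i _ x _ <-. Qed.

End Ideals.

Section Minors.
Variable R : comNzRingType.

(** Listing the image of [g] increasingly gives [h]; then [s] is the rank in
    that list. *)
Lemma ord_sort t m (g : 'I_t -> 'I_m) : injective g ->
  exists (h : 'I_t -> 'I_m) (s : 'I_t -> 'I_t),
    [/\ {homo h : i j / (i < j)%N}, injective s & g =1 h \o s].
Proof.
move=> g_inj; pose e := enum [set g i | i in 'I_t].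
have size_e : size e = t by rewrite -cardE card_imset // card_ord.
have e_sorted : sorted ltn (map val e).
  rewrite /e /enum_mem -enumT sorted_map.
  apply: sorted_filter; first by move=> ? ? ?; apply: ltn_trans.
  by rewrite -sorted_map val_enum_ord iota_ltn_sorted.
have lt_e (i : 'I_t) : (i < size e)%N by rewrite size_e.
have mem_e i : g i \in e by rewrite mem_enum imset_f.
have lt_s i : (index (g i) e < t)%N.
  by rewrite -[X in (_ < X)%N]size_e index_mem.
exists (fun i => tnth (in_tuple e) (Ordinal (lt_e i))).
exists (fun i => Ordinal (lt_s i)); split=> [i j lt_ij | i j [] | i /=].
- have x0 := tnth (in_tuple e) (Ordinal (lt_e i)).
  rewrite !(tnth_nth x0) /= -!(nth_map x0 (val x0) val) //.
  by rewrite (sorted_ltn_nth ltn_trans) ?inE ?size_map.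
- move=> eq_ij; apply: g_inj.
  by rewrite -(nth_index (g i) (mem_e i)) eq_ij nth_index.
- by rewrite (tnth_nth (g i)) /= nth_index.
Qed.

(** The generators of [minors_ideal] only use increasing column maps.  Any other
    column map either repeats a column or is a permutation of such a map. *)
Lemma minor_mem a m t (A : 'M[R]_(a, m)) (f : 'I_t -> 'I_a) (g : 'I_t -> 'I_m) :
  {homo f : i j / (i < j)%N} -> (\det (mxsub f g A) : R^o) \in minors_ideal A t.
Proof.
move=> f_incr; have [/injectiveP g_inj | ] := boolP (injectiveb g); last first.
  case/injectivePn=> i [j neq_ij eq_g].
  rewrite -det_tr (determinant_alternate neq_ij) ?rpred0 // => k.
  by rewrite !mxE eq_g.
have [h [s [h_incr s_inj g_hs]]] := ord_sort g_inj.
have [b Db] := det_colsub_perm (mxsub f h A) s_inj.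
have -> : mxsub f g A = colsub s (mxsub f h A).
  by apply/matrixP => i j; rewrite !mxE g_hs.
rewrite Db; apply/ideal_sign/ideal_gen_mem; exists f, h; split=> //.
Qed.

Lemma lift_homo n (i : 'I_n.+1) : {homo lift i : j k / (j < k)%N}.
Proof. by move=> j k; rewrite !ltnNge /= leq_bump2. Qed.

(** Expand along the bordering column, then by Cauchy-Binet. *)
Lemma bordered_mem n m (A : 'M[R]_(n.+1, m)) (W : 'M[R]_(m, n)) v :
  (bordered (A *m W) v : R^o) \in minors_ideal A n.
Proof.
rewrite borderedE; apply: rpred_sum => i _; apply/ideal_mulr/ideal_mulr.
have -> : row' i (A *m W) = row' i A *m W.
  by apply/matrixP => j k; rewrite !mxE; apply: eq_bigr => l _; rewrite mxE.
rewrite det_mulmx_cols; apply: rpred_sum => g _; apply: ideal_mulr.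
have -> : colsub g (row' i A) = mxsub (lift i) g A.
  by apply/matrixP => j k; rewrite !mxE.
exact/minor_mem/lift_homo.
Qed.

(** An injection of ['I_n] into ['I_n.+1] misses exactly one index [i], so the
    minor is, up to a sign, the value of the bordered determinant at the [i]-th
    basis vector. *)
Lemma minors_bordered n m (A : 'M[R]_(n.+1, m)) f g : injective f ->
  exists v, \det (mxsub f g A) = bordered (colsub g A) v.
Proof.
move=> f_inj; have [i f_i] : exists i, forall k, i != f k.
  have /subsetPn[i _ f'i] : ~~ (predT \subset codom f).
    apply: contraL (ltnSn n) => /subset_leq_card.
    by rewrite card_codom // !card_ord -leqNgt.
  by exists i => k; apply: contraNneq f'i => ->; apply: codom_f.
have /fin_all_exists[s Ds] k : exists j, f k = lift i j.
  by case: (unlift_some (f_i k)) => j -> _; exists j.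
have s_inj : injective s by move=> j k eq_s; apply: f_inj; rewrite !Ds eq_s.
have [b Db] := det_rowsub_perm (mxsub (lift i) g A) s_inj.
exists ((-1) ^+ b *: ((-1) ^+ i *: delta_mx i 0)).
rewrite !borderedZ bordered_delta (mulrA ((-1) ^+ i)) -exprD addnn.
rewrite -mul2n exprM sqrrN !expr1n mul1r.
have -> : mxsub f g A = rowsub s (mxsub (lift i) g A).
  by apply/matrixP => j k; rewrite !mxE Ds.
by rewrite Db; congr (_ * \det _); apply/matrixP => j k; rewrite !mxE.
Qed.

(** The form in which the ideal of maximal minors is used: it is generated by
    the values of the bordered determinants of the column submatrices. *)
Lemma minors_ideal_ind n m (A : 'M[R]_(n.+1, m)) (P : R -> Prop) :
    P 0 ->
    (forall a g v y, P y -> P (a * bordered (colsub g A) v + y)) ->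
  forall z, (z : R^o) \in minors_ideal A n -> P z.
Proof.
move=> P0 PS; apply: ideal_gen_ind => // a x y [f [g [f_incr _ ->]]] Py.
have f_inj : injective f.
  move=> i j eq_f; apply: contra_eq (erefl (val (f i))) => /eqP.
  by case: (ltngtP i j) => [/f_incr|/f_incr|/val_inj]; rewrite ?eq_f ?ltnn.
have [v ->] := minors_bordered A g f_inj; exact: PS.
Qed.

End Minors.

(** * Linear maps out of free modules *)

Section Lifting.
Variable R : comNzRingType.

Definition lin_of (U V : lmodType R) (f : U -> V) (lin_f : linear f) :
    {linear U -> V} :=
  HB.pack f (GRing.isLinear.Build R U V *:%R f lin_f).

Lemma cV_basis_ext n (V : lmodType R) (f g : {linear 'cV[R]_n -> V}) :
  (forall i, f (delta_mx i 0) = g (delta_mx i 0)) -> f =1 g.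
Proof.
move=> eq_fg v; rewrite (matrix_sum_delta v) !linear_sum; apply: eq_bigr => i _.
by rewrite big_ord1 !linearZ /= eq_fg.
Qed.

Lemma cV_lin n (V : lmodType R) (c : 'I_n -> V) :
  exists f : {linear 'cV[R]_n -> V}, forall i, f (delta_mx i 0) = c i.
Proof.
have lin_f : linear (fun v : 'cV[R]_n => \sum_i v i 0 *: c i).
  move=> a u v; rewrite scaler_sumr -big_split; apply: eq_bigr => i _ /=.
  by rewrite !mxE scalerDl scalerA.
exists (lin_of lin_f) => i /=; rewrite (bigD1 i) //= mxE !eqxx scale1r.
by rewrite big1 ?addr0 // => j neq_ji; rewrite mxE (negPf neq_ji) scale0r.
Qed.

(** Stronger than projectivity: [g] has to reach only the values of [f]. *)
Lemma cV_lift n (M N : lmodType R) (g : {linear M -> N})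
    (f : {linear 'cV[R]_n -> N}) :
    (forall v, exists x, g x = f v) ->
  exists h : {linear 'cV[R]_n -> M}, forall x, g (h x) = f x.
Proof.
move=> im_f; have [c Dc] := choice (fun i => im_f (delta_mx i 0)).
have [h Dh] := cV_lin c; exists h.
by apply: (cV_basis_ext (f := g \o h)) => i /=; rewrite Dh Dc.
Qed.

Lemma projective_cV n : projective ('cV[R]_n : lmodType R).
Proof. by move=> M N g f surj_g; apply: cV_lift => v; apply: surj_g. Qed.

Lemma cV_mx n k (f : {linear 'cV[R]_n -> 'cV[R]_k}) :
  exists F : 'M[R]_(k, n), forall v, f v = F *m v.
Proof.
exists (\matrix_(i, j) f (delta_mx j 0) i 0) => v.
have lin_F : linear (fun v : 'cV[R]_n =>
                       (\matrix_(i, j) f (delta_mx j 0) i 0) *m v).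
  by move=> a x y; rewrite mulmxDr scalemxAr.
apply: (cV_basis_ext (g := lin_of lin_F)) => i /=; rewrite -colE.
by apply/colP=> j; rewrite !mxE.
Qed.

Lemma factor_surj (U M N : lmodType R)
    (p : {linear U -> M}) (q : {linear U -> N}) :
    (forall y, exists x, p x = y) -> (forall x, p x = 0 -> q x = 0) ->
  exists f : {linear M -> N}, forall x, f (p x) = q x.
Proof.
move=> surj_p ker_p; have [s ps] := choice surj_p.
have qsp x : q (s (p x)) = q x.
  by apply/eqP; rewrite -subr_eq0 -linearB ker_p // linearB /= ps subrr.
have lin_f : linear (q \o s).
  move=> a x y; rewrite -[x]ps -[y]ps -linearP /= !qsp.
  by rewrite linearP.
by exists (lin_of lin_f).
Qed.

Lemma isomorphic_cover (U M N : lmodType R)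
    (p : {linear U -> M}) (q : {linear U -> N}) :
    (forall y, exists x, p x = y) -> (forall y, exists x, q x = y) ->
  (forall x, p x = 0 <-> q x = 0) -> isomorphic M N.
Proof.
move=> surj_p surj_q ker_pq.
have [|f fp] := factor_surj (p := p) (q := q) surj_p; first by move=> x /ker_pq.
have [|g gq] := factor_surj (p := q) (q := p) surj_q; first by move=> x /ker_pq.
exists f, g => y; first by have [x <-] := surj_p y; rewrite fp gq.
by have [x <-] := surj_q y; rewrite gq fp.
Qed.

End Lifting.

(** * Local rings *)

Section Local.
Variables (R : comNzRingType) (m : ideal R).
Hypothesis localR : local_ring m.

(** If [x] were not a unit, Zorn's lemma would give a maximal ideal containing
    [x], which can only be [m]. *)
Lemma local_unit (x : R) : (x : R^o) \notin m -> exists y, y * x = 1.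
Proof.
move=> m'x; apply: contrapT => x_nonunit.
pose T := {J : ideal R | (1 : R^o) \notin J /\ (x : R^o) \in J}.
have proper_x :
    (1 : R^o) \notin ideal_gen [set x] /\ (x : R^o) \in ideal_gen [set x].
  split; last exact: ideal_gen_mem.
  apply/negP => /(ideal_gen_ind (P := fun z => exists y, y * x = z)) [].
  - by exists 0; rewrite mul0r.
  - by move=> a _ _ -> [y <-]; exists (a + y); rewrite mulrDl.
  - by move=> y yx; apply: x_nonunit; exists y.
pose t0 : T := exist _ (ideal_gen [set x] : ideal R) proper_x.
pose le : rel T := fun J K => `[< {subset sval J <= sval K} >].
have [J|J1 J2 J3 /asboolP le12 /asboolP le23|A totA|[J [J'1 Jx]] maxJ] :=
  ZL_preorder t0 (R := le).
- exact/asboolP.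
- by apply/asboolP => z /le12/le23.
(* the empty chain is bounded by the ideal [t0] generated by [x] *)
- have [[J0 AJ0]|A0] := pselect (exists J, A J); last first.
    by exists t0 => J AJ; case: A0; exists J.
  pose G : set R := fun z => exists2 J : T, A J & (z : R^o) \in sval J.
  have inG z : (z : R^o) \in ideal_gen G -> G z.
    apply: ideal_gen_ind => [|a y1 y2 [J1 AJ1 J1y1] [J2 AJ2 J2y2]].
      by exists J0; rewrite ?rpred0.
    case: (totA _ _ AJ1 AJ2) => /asboolP le12.
      by exists J2; rewrite // rpredD // ideal_mulr // le12.
    by exists J1; rewrite // rpredD ?ideal_mulr // le12.
  have G_proper : (1 : R^o) \notin ideal_gen G /\ (x : R^o) \in ideal_gen G.
    split; last by apply: ideal_gen_mem; exists J0 => //; case: (svalP J0).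
    by apply/negP => /inG[J _]; apply/negP; case: (svalP J).
  exists (exist _ (ideal_gen G : ideal R) G_proper) => J AJ.
  apply/asboolP => z Jz; by apply: ideal_gen_mem; exists J.
- have Jm : J =i m.
    apply: localR.2; split=> // K leJK K'1 z.
    have K_proper : (1 : R^o) \notin K /\ (x : R^o) \in K.
      by split=> //; apply: leJK.
    have /asboolP leKJ := maxJ (exist _ _ K_proper) (introT (asboolP _) leJK).
    by apply/idP/idP => [/leKJ|/leJK].
  by rewrite -Jm Jx in m'x.
Qed.

Lemma det_congr (J : ideal R) n (A B : 'M[R]_n) :
  (forall i j, (A i j - B i j : R^o) \in J) -> (\det A - \det B : R^o) \in J.
Proof.
move=> AB; rewrite -sumrB; apply: rpred_sum => s _.
rewrite -mulrBr; apply: ideal_sign.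
apply: (big_ind2 (fun a b => (a - b : R^o) \in J)) => [|a b c d Jab Jcd|i _] //.
  by rewrite subrr rpred0.
have -> : a * c - b * d = c * (a - b) + b * (c - d).
  by rewrite !mulrBr addrA (mulrC c) (mulrC c) subrK.
by rewrite rpredD ?ideal_mulr.
Qed.

Lemma local_mx_unit n (E : 'M[R]_n) :
    (forall i j, (E i j - (1%:M : 'M_n) i j : R^o) \in m) ->
  exists F : 'M[R]_n, F *m E = 1%:M /\ E *m F = 1%:M.
Proof.
move=> /det_congr; rewrite det1 => mE.
have [|y yE] := @local_unit (\det E).
  apply: contra localR.1.1 => m_det; have := ideal_sub m_det mE.
  by rewrite subKr.
exists (y *: \adj E); rewrite -scalemxAl -scalemxAr mul_adj_mx mul_mx_adj.
by rewrite scale_scalar_mx yE.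
Qed.

(** Nakayama's lemma for the module [V] generated by the images of the basis
    vectors: these are combinations [N] of each other with coefficients in [m],
    and [1%:M - N] is invertible. *)
Lemma nakayama n (V : lmodType R) (p : {linear 'cV[R]_n -> V}) :
    (forall v, exists w : 'cV[R]_n,
        (forall i, (w i 0 : R^o) \in m) /\ p v = p w) ->
  forall v, p v = 0.
Proof.
move=> mV; have [M MP] := choice (fun j => mV (delta_mx j 0)).
pose N : 'M[R]_n := \matrix_(i, j) M j i 0.
have pN v : p ((1%:M - N) *m v) = 0.
  have lin_f : linear (fun v : 'cV[R]_n => p ((1%:M - N) *m v)).
    by move=> a x y; rewrite mulmxDr -scalemxAr linearP.
  rewrite (_ : 0 = (\0%R : {linear 'cV[R]_n -> V}) v) //.
  apply: (cV_basis_ext (f := lin_of lin_f)) => j /=.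
  rewrite mulmxBl mul1mx linearB /= (MP j).2 -linearB /=.
  rewrite (_ : N *m _ = M j) ?subrr ?linear0 //.
  by rewrite -colE; apply/colP=> i; rewrite !mxE.
have [|F [_ NF] v] := @local_mx_unit _ (1%:M - N).
  move=> i j; rewrite !mxE addrAC subrr sub0r -mulN1r ideal_mulr //.
  by case: (MP j).
by rewrite -[v]mul1mx -NF -mulmxA pN.
Qed.

End Local.

(** * Finite presentations over Noetherian rings *)

Section Noetherian.
Variable R : comNzRingType.
Hypothesis noethR : noetherian R.

Lemma seq_span (s : seq R) z : (z : R^o) \in ideal_gen [set x | x \in s] ->
  exists w : 'I_(size s) -> R, z = \sum_i w i * s`_i.
Proof.
apply: (ideal_gen_ind
  (P := fun z => exists w : 'I_(size s) -> R, z = \sum_i w i * s`_i)).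
  by exists (fun=> 0); rewrite big1 // => i _; rewrite mul0r.
move=> a x _ /= s_x [w ->].
have lt_x : (index x s < size s)%N by rewrite index_mem.
exists (fun i => a *+ (i == Ordinal lt_x) + w i).
under [RHS]eq_bigr do rewrite mulrDl; rewrite big_split /=; congr (_ + _).
rewrite (bigD1 (Ordinal lt_x)) //= eqxx nth_index //.
rewrite big1 ?addr0 // => i /negPf->; by rewrite mul0r.
Qed.

(** By induction on [n]: the first coordinates of the elements of [K] form an
    ideal, hence come from finitely many of them, the columns of [L] below.
    Subtracting a combination of these leaves elements of [K] with first
    coordinate zero, to which the induction hypothesis applies. *)
Lemma noetherian_cV n (K : 'cV[R]_n -> Prop) :
    K 0 -> (forall a u v, K u -> K v -> K (a *: u + v)) ->
  exists k (B : 'M[R]_(n, k)),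
    forall v, K v <-> exists w : 'cV[R]_k, v = B *m w.
Proof.
elim: n => [|n IHn] in K *.
  move=> K0 _; exists 0, 0 => v; rewrite (flatmx0 v); split=> // _.
  by exists 0; rewrite flatmx0.
rewrite -[n.+1]/(1 + n)%N in K * => K0 KP.
have K_sum k (c : 'I_k -> R) b : (forall i, K (b i)) -> K (\sum_i c i *: b i).
  move=> Kb; apply: (big_ind K) => // [u v Ku|i _].
    by rewrite -[u]scale1r; apply: KP.
  by rewrite -[_ *: _]addr0; apply: KP.
pose J : ideal R := ideal_gen [set z | exists2 v, K v & usubmx v 0 0 = z].
have inJ z : (z : R^o) \in J -> exists2 v, K v & usubmx v 0 0 = z.
  apply: (ideal_gen_ind (P := fun z => exists2 v, K v & usubmx v 0 0 = z)).
    by exists 0; rewrite // mxE mxE.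
  move=> a _ _ [v Kv <-] [w Kw <-]; exists (a *: v + w); first exact: KP.
  by rewrite !mxE.
have [s Js] := noethR J.
have [i|b Kb Db] := fin_all_exists2 (fun i : 'I_(size s) => inJ s`_i _).
  by rewrite Js ideal_gen_mem //= mem_nth.
pose L : 'M[R]_(1 + n, size s) := \matrix_(i, j) b j i 0.
have LE w : L *m w = \sum_j w j 0 *: b j.
  apply/colP => i; rewrite mxE summxE; apply: eq_bigr => j _.
  by rewrite !mxE mulrC.
have [||k [B BP]] := IHn (fun u => K (col_mx 0 u)); first by rewrite col_mx0.
  move=> a u v Ku Kv.
  by rewrite -[X in col_mx X _](addr0 0) -[X in col_mx (X + _) _](scaler0 _ a)
             -add_col_mx -scale_col_mx; apply: KP.
exists (size s + k)%N, (row_mx L (col_mx 0 B)) => v; split=> [Kv | [w ->]].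
  have /seq_span[w Dw] : (usubmx v 0 0 : R^o) \in ideal_gen [set x | x \in s].
    by rewrite -Js ideal_gen_mem //=; exists v.
  pose u := \col_i w i : 'cV_(size s).
  have KvL : K (- 1 *: (L *m u) + v).
    by apply: KP => //; rewrite LE; apply: K_sum.
  have Dv : - 1 *: (L *m u) + v = col_mx 0 (dsubmx (- 1 *: (L *m u) + v)).
    rewrite -[LHS]vsubmxK; congr col_mx; apply/matrixP => i j; rewrite !ord1.
    rewrite linearP /= [LHS]mxE Dw mxE mxE LE summxE mulN1r addrC; apply/eqP.
    rewrite mxE subr_eq0; apply/eqP/eq_bigr => l _.
    by rewrite -Db !mxE.
  move: KvL; rewrite Dv => /BP[w' Dw']; exists (col_mx u w').
  rewrite mul_row_col mul_col_mx mul0mx -Dw' -Dv scaleN1r addrA subrr add0r //.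
rewrite -[w]vsubmxK mul_row_col mul_col_mx mul0mx -[L *m _]scale1r; apply: KP.
  by rewrite LE; apply: K_sum.
by apply/BP; exists (dsubmx w).
Qed.

Lemma noetherian_presents (I : ideal R) :
  exists n k (A : 'M[R]_(n, k)), presents A (submod_type I).
Proof.
have [s Is] := noethR I.
have Is_i (i : 'I_(size s)) : (s`_i : R^o) \in I.
  by rewrite Is ideal_gen_mem //= mem_nth.
have [p Dp] := cV_lin (fun i : 'I_(size s) =>
  Sub (s`_i : R^o) (Is_i i) : submod_type I).
have [||k [A AP]] := noetherian_cV (K := fun v => p v = 0).
- exact: linear0.
- by move=> a u v pu pv; rewrite linearP /= pu pv scaler0 addr0.
exists (size s), k, A, p; split=> // y.
have /seq_span[w Dw] : (val y : R^o) \in ideal_gen [set x | x \in s].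
  by rewrite -Is; apply: (valP y).
exists (\col_i w i); apply: val_inj; rewrite Dw.
rewrite [X in p X]matrix_sum_delta linear_sum /= submod_val_sum.
by apply: eq_bigr => i _; rewrite big_ord1 mxE linearZ /= Dp.
Qed.

(** So [presentation] does not fall back on its default value. *)
Lemma presentationP (I : ideal R) :
  presents (tagged (presentation (submod_type I))) (submod_type I).
Proof.
have [n [k [A AI]]] := noetherian_presents I.
pose T := {d : nat * nat & 'M[R]_(d.1, d.2)}.
pose P : set T := fun B => presents (tagged B) (submod_type I).
apply: (@xgetPex _ _ P).
by exists (Tagged (fun d : nat * nat => 'M[R]_(d.1, d.2))
                 (A : 'M_((n, k).1, (n, k).2))).
Qed.

End Noetherian.

(** * Factoring matrices *)

Section Columns.
Variable R : comNzRingType.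

Lemma mulmx_col_inj a b (A B : 'M[R]_(a, b)) :
  (forall v : 'cV[R]_b, A *m v = B *m v) -> A = B.
Proof.
move=> AB; apply/matrixP => i j.
by have /colP/(_ i) := AB (delta_mx j 0); rewrite -!colE !mxE.
Qed.

Lemma mx_factor a b c (A : 'M[R]_(a, b)) (C : 'M[R]_(a, c)) :
    (forall w : 'cV[R]_c, exists u : 'cV[R]_b, C *m w = A *m u) ->
  exists W : 'M[R]_(b, c), C = A *m W.
Proof.
move=> imC.
have [|f Df] := cV_lift (g := (mulmx A : {linear 'cV[R]_b -> 'cV[R]_a}))
                        (f := (mulmx C : {linear 'cV[R]_c -> 'cV[R]_a})).
  by move=> w; have [u] := imC w; exists u.
have [W DW] := cV_mx f; exists W; apply: mulmx_col_inj => w.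
rewrite -mulmxA -DW; exact/esym/Df.
Qed.

Lemma colsubE a b c (g : 'I_c -> 'I_b) (A : 'M[R]_(a, b)) :
  colsub g A = A *m colsub g 1%:M.
Proof. by rewrite mulmx_colsub mulmx1. Qed.

Lemma set_colM a b c (A : 'M[R]_(a, b)) (W : 'M[R]_(b, c)) k w :
  set_col (A *m W) k (A *m w) = A *m set_col W k w.
Proof.
apply/matrixP => i j; rewrite !mxE; case: eqP => [->|neq_jk].
  by apply: eq_bigr => l _; rewrite !mxE eqxx.
by apply: eq_bigr => l _; rewrite !mxE (introF eqP neq_jk).
Qed.

End Columns.

(** * Projective dimension at most one *)

Section Image.
Variables (R : comNzRingType) (M N : lmodType R) (g : {linear M -> N}).

Definition image_pred : {pred N} := fun y => `[< exists x, g x = y >].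

Fact image_pred_closed : GRing.submod_closed image_pred.
Proof.
split=> [|a y z /asboolP[u <-] /asboolP[v <-]]; apply/asboolP.
  by exists 0; rewrite linear0.
by exists (a *: u + v); rewrite linearP.
Qed.

HB.instance Definition _ :=
  GRing.isSubmodClosed.Build R N image_pred image_pred_closed.

(** As in [cV_lift], [g] has to reach only the values of [f]: replace [N] by the
    image of [g]. *)
Lemma projective_lift (P : lmodType R) (f : {linear P -> N}) :
    projective P -> (forall v, exists x, g x = f v) ->
  exists h : {linear P -> M}, forall x, g (h x) = f x.
Proof.
move=> projP imf.
have g_im x : g x \in image_pred by apply/asboolP; exists x.
have f_im v : f v \in image_pred by apply/asboolP; apply: imf.
pose g' x : submod_type image_pred := Sub (g x) (g_im x).
pose f' v : submod_type image_pred := Sub (f v) (f_im v).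
have lin_g : linear g' by move=> a x y; apply: val_inj; rewrite /= linearP.
have lin_f : linear f' by move=> a x y; apply: val_inj; rewrite /= linearP.
have [|h gh] := projP _ _ (lin_of lin_g) (lin_of lin_f).
  by move=> y; have /asboolP[x gx] := valP y; exists x; apply: val_inj.
by exists h => x; have /(congr1 val) := gh x.
Qed.

End Image.

Section Resolutions.
Variable R : comNzRingType.

Lemma short_pd_le (M : lmodType R) a b
    (p : {linear 'cV[R]_a -> M}) (B : 'M[R]_(a, b)) :
    (forall y, exists v, p v = y) ->
    (forall v, p v = 0 <-> exists w : 'cV[R]_b, v = B *m w) ->
    (forall w : 'cV[R]_b, B *m w = 0 -> w = 0) ->
  pd_le M 1.
Proof.
move=> surj_p ker_p inj_B.
pose dim i := if i is i'.+1 then if i' is _.+1 then 0%N else b else a.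
pose D i : 'M[R]_(dim i, dim i.+1) :=
  if i is 0 then B else 0.
exists (fun i => 'cV[R]_(dim i) : lmodType R).
exists (fun i =>
  (mulmx (D i) : {linear 'cV[R]_(dim i.+1) -> 'cV[R]_(dim i)})), p.
split; last by case=> [|[|i]] // _ x; apply: flatmx0.
split=> // [i|[|i] x].
- exact: projective_cV.
- split=> [/inj_B-> | [z ->]]; first by exists 0; rewrite linear0.
  by rewrite /= mul0mx mulmx0.
- split=> [_|[z ->]]; last by rewrite /= !mul0mx.
  by exists 0; rewrite /= mul0mx; exact: flatmx0.
Qed.

Variable m : ideal R.
Hypothesis localR : local_ring m.

(** Take [C] with the least possible number [k] of columns.  By
    Schanuel's argument, [ker p] is projective, since the first syzygy [P 1] of
    the given resolution is.  A section of [R^k -> ker p], composed with [C], is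
    an endomorphism [E] of [R^k] such that [C *m E = C] and that vanishes on
    [ker C].  The columns of [E - 1] are relations between the columns
    of [C]; by minimality their entries are not units, so they lie in [m], and
    [E] is invertible.  Hence [ker C = 0]. *)
Lemma pd1_injective_presentation (M : lmodType R) a b
    (p : {linear 'cV[R]_a -> M}) (A : 'M[R]_(a, b)) :
    pd_le M 1 -> (forall y, exists v, p v = y) ->
    (forall v, p v = 0 <-> exists w : 'cV[R]_b, v = A *m w) ->
  exists k (C : 'M[R]_(a, k)),
    (forall v, p v = 0 <-> exists w : 'cV[R]_k, v = C *m w) /\
    (forall w : 'cV[R]_k, C *m w = 0 -> w = 0).
Proof.
move=> [P [d [e [[projP surj_e ker_e ker_d] P0]]]] surj_p ker_p.
pose gens k := exists C : 'M[R]_(a, k),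
  forall v, p v = 0 <-> exists w : 'cV[R]_k, v = C *m w.
have ex_k : exists k, `[< gens k >] by exists b; apply/asboolP; exists A.
case: (ex_minnP ex_k) => k /asboolP[C ker_C] min_k; exists k, C; split=> //.
have pC w : p (C *m w) = 0 by apply/ker_C; exists w.
have inj_d0 z : d 0 z = 0 -> z = 0.
  by move/ker_d => [u ->]; rewrite (P0 2 _ u) ?linear0.
(* [f] and [b'] compare the two covers [p] and [e] of [M]; a vector [v] of
   [ker p] is the sum of [v - b' (f v)], lifted along [C] by [h], and of
   [b' (f v)], where [f v] is in [ker e] and comes from [P 1], lifted by [g]. *)
have [|f ef] := cV_lift (g := e) (f := p); first by move=> v; apply: surj_e.
have [b' pb] := projP 0 _ _ p e surj_p.
have lin_r : linear (fun v => v - b' (f v)).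
  by move=> t u v; rewrite !linearP scalerDr addrACA.
pose Cl := mulmx C : {linear 'cV[R]_k -> 'cV[R]_a}.
have [|h Ch] := cV_lift (g := Cl) (f := lin_of lin_r).
  move=> v /=; have /ker_C[w ->] : p (v - b' (f v)) = 0; last by exists w.
  by rewrite linearB /= pb ef subrr.
have lin_bd : linear (fun z => b' (d 0 z)) by move=> t u v; rewrite !linearP.
have [|g Cg] := projective_lift (g := Cl) (f := lin_of lin_bd) (projP 1).
  move=> z /=; have /ker_C[w ->] : p (b' (d 0 z)) = 0; last by exists w.
  by rewrite pb; apply/ker_e; exists z.
have lin_fC : linear (fun w : 'cV[R]_k => f (C *m w)).
  by move=> t u v; rewrite mulmxDr -scalemxAr linearP.
have [|z dz] := cV_lift (g := d 0) (f := lin_of lin_fC).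
  move=> w /=; have /ker_e[u ->] : e (f (C *m w)) = 0 by rewrite ef pC.
  by exists u.
have lin_E : linear (fun w : 'cV[R]_k => h (C *m w) + g (z w)).
  move=> t u v; rewrite mulmxDr -scalemxAr !linearP scalerDr addrACA //.
have [E DE] := cV_mx (lin_of lin_E).
have CE : C *m E = C.
  apply: mulmx_col_inj => w; rewrite -mulmxA -DE /= mulmxDr.
  have /= -> := Ch (C *m w); have /= -> := Cg (z w).
  by have /= -> := dz w; rewrite subrK.
have kerE (w : 'cV[R]_k) : C *m w = 0 -> E *m w = 0.
  move=> Cw; rewrite -DE /= Cw linear0 add0r (inj_d0 (z w)) ?linear0 //.
  by have /= -> := dz w; rewrite Cw linear0.
have [|F [FE _]] := local_mx_unit localR (E := E); last first.
  by move=> w /kerE Ew; rewrite -[w]mul1mx -FE -mulmxA Ew mulmx0.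
(* a unit entry [(i, j)] of [E - 1] makes column [i] of [C] redundant *)
move=> i j; apply: contraT => /(local_unit localR)[y yE].
clear h Ch g Cg z dz lin_E DE lin_fC kerE Cl.
case: k => [|k] in C E i j ker_C pC min_k CE yE *.
  by case: i yE.
suff /asboolP/min_k : gens k by rewrite ltnn.
exists (col' i C) => v; split=> [/ker_C[w ->] | [w ->]]; last first.
  by rewrite [col' i C](colsubE (lift i) C) -mulmxA pC.
(* a preimage of [C *m w] whose [i]-th coordinate vanishes *)
pose w' := w - (w i 0 * y) *: (col j (E - 1%:M)).
have w'i : w' i 0 = 0.
  rewrite !mxE in yE *; by rewrite -mulrA yE mulr1 subrr.
have Cw' : C *m w' = C *m w.
  rewrite mulmxBr -scalemxAr colE mulmxA mulmxBr CE mulmx1 subrr mul0mx scaler0.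
  by rewrite subr0.
exists (row' i w'); rewrite -Cw'; apply/matrixP => s t.
rewrite ord1 !mxE (bigD1_ord i) //= w'i mulr0 add0r.
by apply: eq_bigr => l _; rewrite !mxE.
Qed.

End Resolutions.

(** * The ideal of maximal minors of a presentation of an ideal *)

Section Presented.
Variables (R : comNzRingType) (I : ideal R).
Hypothesis regI : regular_ideal I.

Lemma lreg_neq0 (r : R) : GRing.lreg r -> r <> 0.
Proof.
move=> reg_r r0; move/eqP: (oner_neq0 R); apply; apply: reg_r.
by rewrite r0 !mul0r.
Qed.

Lemma lreg_eq0 (r a : R) : GRing.lreg r -> r * a = 0 -> a = 0.
Proof. by move=> reg_r ra; apply: reg_r; rewrite mulr0. Qed.

Lemma regular_ideal_faithful (a : R) :
  (forall y : submod_type I, a * val y = 0) -> a = 0.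
Proof.
have [r Ir reg_r] := regI => aI; apply: (lreg_eq0 reg_r).
by rewrite mulrC; apply: (aI (Sub (r : R^o) Ir)).
Qed.

Lemma cV_to_ideal n (p : {linear 'cV[R]_n -> submod_type I}) :
  exists x : 'rV[R]_n, forall v, val (p v) = (x *m v) 0 0 :> R.
Proof.
exists (\row_j val (p (delta_mx j 0))) => v.
rewrite [in LHS](matrix_sum_delta v) linear_sum submod_val_sum mxE.
by apply: eq_bigr => i _; rewrite big_ord1 linearZ /= mxE mulrC.
Qed.

Variables (n k : nat) (A : 'M[R]_(n.+1, k)).
Variable p : {linear 'cV[R]_n.+1 -> submod_type I}.
Hypothesis surj_p : forall y, exists v, p v = y.
Hypothesis ker_p : forall v, p v = 0 <-> exists w : 'cV[R]_k, v = A *m w.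

Lemma submod_val_eq0 (y : submod_type I) : val y = 0 -> y = 0.
Proof. by move=> y0; apply: val_inj. Qed.

Lemma bordered_ker_cross (B : 'M[R]_(n.+1, n)) v w :
    (forall u : 'cV[R]_n, p (B *m u) = 0) ->
  bordered B v * val (p w) = val (p v) * bordered B w.
Proof.
move=> pB; have [x Dx] := cV_to_ideal p.
rewrite !Dx; apply: bordered_cross; apply: mulmx_col_inj => u.
apply/colP => i; rewrite !ord1 -mulmxA -Dx pB mul0mx mxE //.
Qed.

Lemma bordered_ker0 (B : 'M[R]_(n.+1, n)) v :
    (forall u : 'cV[R]_n, p (B *m u) = 0) -> p v = 0 -> bordered B v = 0.
Proof.
move=> pB pv; apply: regular_ideal_faithful => y; have [w <-] := surj_p y.
by rewrite (bordered_ker_cross _ _ pB) pv mul0r.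
Qed.

Lemma p_imA l (W : 'M[R]_(k, l)) u : p (A *m W *m u) = 0.
Proof. by apply/ker_p; exists (W *m u); rewrite mulmxA. Qed.

Notation Fitt := (minors_ideal A n).

Definition minor_map (W : 'M[R]_(k, n)) (v : 'cV[R]_n.+1) : submod_type Fitt :=
  Sub (bordered (A *m W) v : R^o) (bordered_mem A W v).

Lemma minor_map_linear W : linear (minor_map W).
Proof. by move=> a u v; apply: val_inj; apply: borderedP. Qed.

(** The part of the Hilbert-Burch theorem that produces the isomorphism.  With
    [r = p c] regular in [I], the vectors [r e_j - x_j c] are in [ker p], which
    gives [W] with [C *m W = r%:M - c *m x]; then [U = (c | C)] and
    [V = (x ; W)] satisfy [U *m V = r%:M] and [V *m U = r%:M].  Both products
    have regular, hence nonzero, determinants, which forces [U] to be square and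
    its determinant [bordered C c] to be regular. *)
Lemma hilbert_burch l (C : 'M[R]_(n.+1, l)) :
    (forall v, p v = 0 <-> exists w : 'cV[R]_l, v = C *m w) ->
    (forall w : 'cV[R]_l, C *m w = 0 -> w = 0) ->
  isomorphic (submod_type Fitt) (submod_type I).
Proof.
move=> ker_C inj_C; have [r Ir reg_r] := regI.
have [c Dc] := surj_p (Sub (r : R^o) Ir).
have [x Dx] := cV_to_ideal p.
have xc : x *m c = r%:M by apply/matrixP=> i j; rewrite !ord1 -Dx Dc mxE.
have pC w : p (C *m w) = 0 by apply/ker_C; exists w.
have xC : x *m C = 0.
  apply: mulmx_col_inj => u; apply/colP => i.
  by rewrite !ord1 -mulmxA -Dx pC mul0mx mxE.
have inj_CM q (X : 'M_(l, q)) : C *m X = 0 -> X = 0.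
  move=> CX; apply: mulmx_col_inj => w; rewrite mul0mx; apply: inj_C.
  by rewrite mulmxA CX mul0mx.
have [|W DW] := mx_factor (A := C) (C := r%:M - c *m x).
  move=> w; apply/ker_C; apply: submod_val_eq0.
  rewrite Dx mulmxA mulmxBr mul_mx_scalar.
  by rewrite mulmxA xc mul_scalar_mx subrr mul0mx mxE.
pose U : 'M_(n.+1, 1 + l) := row_mx c C.
pose V : 'M_(1 + l, n.+1) := col_mx x W.
have UV : U *m V = r%:M by rewrite mul_row_col -DW addrC subrK.
have VU : V *m U = r%:M.
  rewrite mul_col_row xc xC scalar_mx_block; congr block_mx.
    by apply: inj_CM; rewrite mulmxA -DW mulmxBl mul_scalar_mx -mulmxA xc
                              mul_mx_scalar subrr.
  apply/eqP; rewrite -subr_eq0; apply/eqP/inj_CM.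
  rewrite mulmxBr mulmxA -DW mulmxBl -mulmxA xC mulmx0 subr0.
  by rewrite mul_scalar_mx mul_mx_scalar subrr.
have det_r s : \det (r%:M : 'M_s) <> 0.
  by rewrite det_scalar; apply/lreg_neq0/lregX.
have eq_ln : l = n.
  case: (ltngtP l n) => // [lt_ln | lt_nl].
    by case: (det_r n.+1); rewrite -UV det_mulmx_narrow.
  by case: (det_r (1 + l)%N); rewrite -VU det_mulmx_narrow.
subst l.
have reg_c : GRing.lreg (bordered C c).
  move=> s t eq_st; have reg_rn : GRing.lreg (r ^+ n.+1) by apply: lregX.
  apply: reg_rn.
  have Dr : r ^+ n.+1 = \det (V : 'M_n.+1) * bordered C c.
    by rewrite -det_scalar -UV det_mulmx mulrC.
  by rewrite Dr -!mulrA eq_st.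
have [|W' DW'] := mx_factor (A := A) (C := C).
  by move=> w; apply/ker_p.
have qP : forall v, val (lin_of (minor_map_linear W') v) = bordered C v.
  by move=> v; rewrite DW'.
apply: (isomorphic_cover (p := lin_of (minor_map_linear W')) (q := p)) => //
  [y|v].
  suff [v Dv] : exists v, bordered C v = val y.
    by exists v; apply: val_inj; rewrite qP.
  move: (val y) (valP y); apply: minors_ideal_ind.
    by exists 0; rewrite -(scale0r 0) borderedZ mul0r.
  move=> a g v z [u <-].
  have [|X ->] := mx_factor (A := C) (C := colsub g A).
    by move=> w; apply/ker_C; rewrite colsubE p_imA.
  by exists (a *: (\det X *: v) + u); rewrite borderedP borderedZ bordered_mul.
split=> [/(congr1 val) | pv].
  rewrite qP /= => Cv0; apply: submod_val_eq0; apply: (lreg_eq0 reg_c).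
  by rewrite bordered_ker_cross // Cv0 mulr0.
by apply: val_inj; rewrite qP bordered_ker0.
Qed.

Variable m : ideal R.
Hypothesis localR : local_ring m.
Hypothesis homI : bijective (@homothety R (submod_type I)).
Variable psi : {linear submod_type Fitt -> submod_type I}.
Hypothesis psi_bij : bijective psi.

(** By [bordered_ker0], [psi \o minor_map W] factors through [p] as an
    endomorphism of [I]. *)
Lemma minor_map_homothety W :
  exists r, forall v, psi (minor_map W v) = r *: p v.
Proof.
have lin_f : linear (fun v => psi (minor_map W v)).
  by move=> a u v; rewrite minor_map_linear linearP.
have [|f Df] := factor_surj (p := p) (q := lin_of lin_f) surj_p.
  move=> v pv /=; rewrite (_ : minor_map W v = 0) ?linear0 //.
  by apply: val_inj; apply: bordered_ker0 => // u; apply: p_imA.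
have [h _ hK] := homI; exists (h f) => v.
have /= -> := congr1 (fun F : {linear _ -> _} => F (p v)) (hK f).
by rewrite Df.
Qed.

(** If no scalar of [minor_map_homothety] is a unit, all are in [m]; as the values
    of the maps [minor_map W] generate the ideal of minors, [psi] then sends it
    into [m I], although [psi] is onto [I]. *)
Lemma minor_map_unit : exists W u r,
  u * r = 1 /\ forall v, psi (minor_map W v) = r *: p v.
Proof.
have [r Dr] := choice minor_map_homothety.
have [[W m'r] | all_m] := pselect (exists W, (r W : R^o) \notin m).
  by have [u ur] := local_unit localR m'r; exists W, u, (r W).
have mr W : (r W : R^o) \in m by apply: contraT => m'r; case: all_m; exists W.
have [s Is reg_s] := regI; have [c Dc] := surj_p (Sub (s : R^o) Is).
case: (lreg_neq0 reg_s); have -> : s = val (p c) by rewrite Dc.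
rewrite (nakayama localR (p := p)) // => v.
have [phi psiK phiK] := psi_bij; rewrite -[p v]phiK.
suff : forall z, (z : R^o) \in Fitt -> forall Fz : (z : R^o) \in Fitt,
    exists w : 'cV[R]_n.+1,
    (forall i, (w i 0 : R^o) \in m) /\ psi (Sub (z : R^o) Fz) = p w.
  move/(_ _ (valP (phi (p v))) (valP (phi (p v)))) => [w [mw Dw]].
  exists w; split=> //.
  by rewrite -Dw; congr (psi _); apply: val_inj.
apply: minors_ideal_ind => [F0 | a g b y IHy Fz].
  exists 0; split=> [i|]; first by rewrite mxE rpred0.
  by rewrite (_ : Sub _ _ = 0) ?linear0 //; apply: val_inj.
pose W := colsub g 1%:M : 'M[R]_(k, n).
have Fy : (y : R^o) \in Fitt.
  have -> : y = (a * bordered (colsub g A) b + y) - a * bordered (colsub g A) b.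
    by rewrite addrAC subrr add0r.
  by rewrite ideal_sub // ideal_mulr // colsubE bordered_mem.
have [w [mw Dw]] := IHy Fy.
exists ((a * r W) *: b + w); split=> [i|].
  by rewrite !mxE rpredD // mulrC ideal_mulr // ideal_mulr.
rewrite linearP -Dw -scalerA -Dr -linearP; congr (psi _); apply: val_inj.
by rewrite /= [in LHS]colsubE.
Qed.

(** Take [W] from [minor_map_unit].  The form [bordered (A *m W)] is, up to the
    isomorphism [psi] and a unit, the map [p], so its values have no common
    annihilator.  Replacing the column [i] of [A *m W] by [v] in [ker p]
    multiplies this form by the scalar [r' i * u]; these scalars are the
    coordinates of a preimage of [v], by [bordered_cramer]. *)
Lemma minors_iso_pd_le : pd_le (submod_type I) 1.
Proof.
have [W [u [r [ur Dr]]]] := minor_map_unit.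
have faithful a : (forall v, bordered (A *m W) v * a = 0) -> a = 0.
  move=> Da; have ra : a * r = 0.
    apply: regular_ideal_faithful => y; have [v <-] := surj_p y.
    rewrite -mulrA -(submod_valZ r) -Dr -submod_valZ -linearZ.
    rewrite (_ : a *: _ = 0) ?linear0 //; apply: val_inj.
    by rewrite submod_valZ mulrC Da.
  by rewrite -[a]mulr1 -ur mulrCA ra mulr0.
have cV0 l (w : 'cV[R]_l) : (forall v, bordered (A *m W) v *: w = 0) -> w = 0.
  move=> Dw; apply/colP => i; rewrite mxE; apply: faithful => v.
  by have /colP/(_ i) := Dw v; rewrite !mxE.
apply: (short_pd_le (p := p) (B := A *m W)) => // [v|w].
  split=> [pv0 | [w ->]]; last exact: p_imA.
  have [w0 Dv] := iffLR (ker_p v) pv0.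
  have [r' Dr'] := choice (fun i => minor_map_homothety (set_col W i w0)).
  exists (\col_i (r' i * u)); apply/eqP; rewrite -subr_eq0; apply/eqP.
  apply: cV0 => t; rewrite scalerBr bordered_cramer.
  rewrite (bordered_ker0 _ pv0) ?scale0r ?add0r; last exact: p_imA.
  rewrite scalemxAr; apply/eqP; rewrite subr_eq0; apply/eqP; congr (_ *m _).
  apply/colP => i; rewrite !mxE Dv set_colM.
  have [phi psiK _] := psi_bij.
  have /(congr1 val) : minor_map (set_col W i w0) t =
                       (r' i * u) *: minor_map W t.
    by apply: (can_inj psiK); rewrite linearZ /= Dr Dr' scalerA -mulrA ur mulr1.
  by rewrite submod_valZ mulrC.
move=> Bw; apply: cV0 => v; exact: bordered_ann.
Qed.

End Presented.

Theorem proposition2p1 (R : comNzRingType) (m : ideal R)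
    (noethR : noetherian R) (localR : local_ring m)
    (I : ideal R) (regI : regular_ideal I)
    (homI : bijective (@homothety R (submod_type I))) :
  pd_le (submod_type I) 1 <->
  isomorphic (submod_type (fitting 1 (submod_type I))) (submod_type I).
Proof.
rewrite /fitting; have := presentationP noethR I.
(* with no generator, [I] would be zero *)
case: (presentation _) => -[[|n] k] /= A [p [surj_p ker_p]].
  have [r Ir /lreg_neq0[]] := regI; have [v Dv] := surj_p (Sub (r : R^o) Ir).
  by have -> : r = val (p v); [rewrite Dv | rewrite (flatmx0 v) linear0].
rewrite subn1 /=; split=> [pd_I | [psi psi_bij]].
  have [l [C [ker_C inj_C]]] :=
    pd1_injective_presentation localR pd_I surj_p ker_p.
  exact: (hilbert_burch regI surj_p ker_p ker_C inj_C).
exact: (minors_iso_pd_le regI surj_p ker_p localR homI psi_bij).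
Qed.
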